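(* Let $\mathcal{E}$ be a solvable evolution algebra over any field $\mathbb{K}$. Then $\mathcal{E}$ is supersolvable if and only if every quotient of $\mathcal{E}$ by a proper ideal is degenerate or has a basic ideal isomorphic to $\mathcal{E}_k(\lambda_1,\dots,\lambda_k)$ for some $\lambda_1,\dots,\lambda_k\in\mathbb{K}$ and some $k\leq\dim\mathcal{E}$.
   Context: An evolution algebra over a field $\mathbb{K}$ is a finite-dimensional $\mathbb{K}$-algebra $\mathcal{E}$ (bilinear product, not necessarily associative) admitting a basis $B=\{e_1,\dots,e_n\}$, called a natural basis, with $e_ie_j=0$ for $i\neq j$. Quotients of evolution algebras by ideals are evolution algebras. Put $\mathcal{E}^{(1)}=\mathcal{E}$, $\mathcal{E}^{(k+1)}=\mathcal{E}^{(k)}\mathcal{E}^{(k)}$ (span of products); $\mathcal{E}$ is solvable if $\mathcal{E}^{(k)}=0$ for some $k$. $\mathrm{ann}(\mathcal{E})=\{x\in\mathcal{E}:x\mathcal{E}=0\}=\mathrm{span}\{e_i\in B: e_i^2=0\}$, and $\mathcal{E}$ is degenerate if $\mathrm{ann}(\mathcal{E})\neq0$. An ideal $I$ is a basic ideal relative to a natural basis $B$ if $I$ is the span of a subset of $B$; ''basic ideal'' without mention of $B$ means basic relative to some natural basis. $\mathcal{E}$ (of dimension $n$) is supersolvable if there is a chain $0=I_0\subsetneq I_1\subsetneq\dots\subsetneq I_n=\mathcal{E}$ of ideals of $\mathcal{E}$ with $\dim I_i=i$ for all $i$. For $k\geq1$ and scalars $\lambda_1,\dots,\lambda_k\in\mathbb{K}$,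 not all zero, with $\sum_{j=1}^k\lambda_j=0$, $\mathcal{E}_k(\lambda_1,\dots,\lambda_k)$ is the evolution algebra with natural basis $\{e_1,\dots,e_k\}$ and product $e_i^2=\lambda_i(e_1+\dots+e_k)$ for $1\leq i\leq k$. *)

(* Defs.v *)
From HB Require Import structures.
From mathcomp Require Import all_boot all_algebra.

Set Implicit Arguments.
Unset Strict Implicit.
Unset Printing Implicit Defensive.

Import GRing.Theory.
Local Open Scope ring_scope.
Local Open Scope quotient_scope.

(* Finite-dimensional algebras, neither associative nor unital in general. *)
HB.mixin Record Vector_isNonassocAlg (K : fieldType) E of Vector K E := {
  amul : E -> E -> E;
  amul_bilinear : bilinear_for *:%R *:%R amul
}.

#[short(type="nonassocAlgType")]
HB.structure Definition NonassocAlg (K : fieldType) :=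
  {E of Vector_isNonassocAlg K E & Vector K E}.

Notation "x ** y" := (amul x y) (at level 40, left associativity) : ring_scope.

HB.instance Definition _ (K : fieldType) (E : nonassocAlgType K) :=
  bilinear_isBilinear.Build K E E E *:%R *:%R (@amul K E) amul_bilinear.

HB.instance Definition _ (K : fieldType) (E : nonassocAlgType K) (x : E) :=
  GRing.isSemilinear.Build K E E *:%R (amul x)
    (GRing.semilinear_linear (amul_bilinear.2 x)).

Section Notions.

Variables (K : fieldType) (E : nonassocAlgType K).
Implicit Types (U V W : {vspace E}) (B : seq E).

(* As [basis_of] makes B duplicate-free, [x != y] means distinct indices. *)
Definition natural_basis B :=
  basis_of {:E} B /\ {in B &, forall x y, x != y -> x ** y = 0}.

Definition evolution_algebra := exists B, natural_basis B.

(* By bilinearity, products of basis vectors span all products of U and V;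
   see [memv_amulv] and [amulv_subP]. *)
Definition amulv U V : {vspace E} :=
  <<[seq x ** y | x <- vbasis U, y <- vbasis V]>>%VS.

Lemma memv_amulv U V x y : x \in U -> y \in V -> x ** y \in amulv U V.
Proof.
move=> /coord_vbasis-> /coord_vbasis->.
rewrite linear_sumr; apply: memv_suml => j _; rewrite linear_sumlz.
apply: memv_suml => i _; rewrite linearZr_LR linearZl_LR /= !memvZ //.
by apply/memv_span/allpairs_f; apply: mem_nth; rewrite size_tuple.
Qed.

Lemma amulv_subP U V W :
  (forall x y, x \in U -> y \in V -> x ** y \in W) <-> (amulv U V <= W)%VS.
Proof.
split=> [UVW | /subvP sUVW x y xU yV]; last by apply/sUVW/memv_amulv.
apply/span_subvP=> _ /allpairsP[[x y] /= [/vbasis_mem ? /vbasis_mem ? ->]].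
exact: UVW.
Qed.

(* [derived k] is E^(k+1), since E^(1) = E. *)
Definition derived k : {vspace E} := iter k (fun U => amulv U U) fullv.

Definition solvable := exists k, derived k = 0%VS.

(* The kernel of x |-> (y |-> x ** y), a linear map into [End(E)]; see [annP]. *)
Definition ann : {vspace E} := lker (linfun (fun x => linfun (amul x))).

Definition degenerate := ann != 0%VS.

Definition ideal_closed U :=
  forall x y, y \in U -> x ** y \in U /\ y ** x \in U.

Record ideal := Ideal {
  ideal_val :> {vspace E};
  idealP : ideal_closed ideal_val
}.

Definition basic_ideal (I : ideal) :=
  exists2 B, natural_basis B
    & exists2 S : seq E, {subset S <= B} & ideal_val I = <<S>>%VS.

Definition supersolvable :=
  exists I : nat -> ideal,
    [/\ ideal_val (I 0%N) = 0%VS,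
        ideal_val (I (\dim {:E})) = fullv,
        forall i, (i < \dim {:E})%N ->
          (I i <= I i.+1)%VS && (ideal_val (I i) != I i.+1)
      & forall i, (i <= \dim {:E})%N -> \dim (I i) = i].

End Notions.

Arguments evolution_algebra {K} E.
Arguments derived {K} E k.
Arguments solvable {K} E.
Arguments ann {K} E.
Arguments degenerate {K} E.
Arguments ideal {K} E.
Arguments supersolvable {K} E.

Section Annihilator.

Variables (K : fieldType) (E : nonassocAlgType K).

Lemma annP (x : E) : reflect (forall y, x ** y = 0) (x \in ann E).
Proof.
have lin : linear (fun x : E => linfun (amul x)).
  by move=> a u v; apply/lfunP=> y; rewrite add_lfunE scale_lfunE !lfunE /= linearPl.
pose F := GRing.isSemilinear.Build K E 'Hom(E, E) *:%R _
  (GRing.semilinear_linear lin).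
pose f : {linear E -> 'Hom(E, E)} := HB.pack (fun x : E => linfun (amul x)) F.
rewrite memv_ker (lfunE f) /=.
apply: (iffP eqP) => [x0 y | x0].
  by have /lfunP/(_ y) := x0; rewrite !lfunE.
by apply/lfunP=> y; rewrite !lfunE /= x0.
Qed.

End Annihilator.

Section IdealAlgebra.

Variables (K : fieldType) (E : nonassocAlgType K) (I : ideal E).

Definition ideal_alg := subvs_of I.

HB.instance Definition _ := Vector.on ideal_alg.

Lemma ideal_mul_subproof (x y : ideal_alg) : vsval x ** vsval y \in ideal_val I.
Proof. by have [] := idealP (vsval x) (subvsP y). Qed.

Definition ideal_mul (x y : ideal_alg) : ideal_alg :=
  Subvs (ideal_mul_subproof x y).

Lemma ideal_mul_bilinear : bilinear_for *:%R *:%R ideal_mul.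
Proof.
by split=> x a u v; apply: val_inj; rewrite /= ?linearPl ?linearPr.
Qed.

HB.instance Definition _ :=
  Vector_isNonassocAlg.Build K ideal_alg ideal_mul_bilinear.

End IdealAlgebra.

(* The quotient of a vector space by a subspace, on the type of cosets
   [Quotient.quot]. *)
Section VectorQuotient.

Variables (K : fieldType) (V : vectType K) (U : {vspace V}).

Definition vquot : Type := Quotient.quot (pred_of_vspace U).

HB.instance Definition _ := Choice.on vquot.
HB.instance Definition _ := EqQuotient.on vquot.
HB.instance Definition _ := GRing.Zmodule.on vquot.

Lemma vquot_eqE (x y : V) : (\pi_vquot x == \pi_vquot y) = (x - y \in U).
Proof. by rewrite Quotient.idealrBE. Qed.

Definition vquot_scale a (x : vquot) : vquot := \pi_vquot (a *: repr x).

Lemma vquot_piZ a : {morph \pi_vquot : x / a *: x >-> vquot_scale a x}.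
Proof.
move=> x; apply/eqP; rewrite vquot_eqE -scalerBr memvZ //.
by rewrite -vquot_eqE reprK.
Qed.

Lemma vquot_scaleA a b (x : vquot) :
  vquot_scale a (vquot_scale b x) = vquot_scale (a * b) x.
Proof. by rewrite -[x]reprK -(vquot_piZ b) -!vquot_piZ scalerA. Qed.

Lemma vquot_scale1 : left_id 1 vquot_scale.
Proof. by move=> x; rewrite -[x]reprK -vquot_piZ scale1r. Qed.

Lemma vquot_piD : {morph \pi_vquot : x y / x + y}.
Proof. exact: Quotient.pi_add. Qed.

Lemma vquot_scaleDr : right_distributive vquot_scale +%R.
Proof.
move=> a x y; rewrite -[x]reprK -[y]reprK.
by rewrite -vquot_piD -!vquot_piZ -vquot_piD scalerDr.
Qed.

Lemma vquot_scaleDl (x : vquot) : {morph vquot_scale^~ x : a b / a + b}.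
Proof.
by move=> a b; rewrite -[x]reprK -!vquot_piZ -vquot_piD scalerDl.
Qed.

HB.instance Definition _ := GRing.Zmodule_isLmodule.Build K vquot
  vquot_scaleA vquot_scale1 vquot_scaleDr vquot_scaleDl.

Lemma vquot_pi_linear : linear \pi_vquot.
Proof. by move=> a x y; rewrite vquot_piD vquot_piZ. Qed.

HB.instance Definition _ := GRing.isSemilinear.Build K V vquot *:%R \pi_vquot
  (GRing.semilinear_linear vquot_pi_linear).

Lemma vquot_vect_iso : Vector.axiom (\dim U^C) vquot.
Proof.
pose p (x : V) : subvs_of U^C := vsproj U^C (x - projv U x).
have p_linear : linear p.
  move=> a x y; rewrite /p -linearP /=; congr (vsproj _ _).
  by rewrite linearP /= scalerBr opprD addrACA.
have pE x : vsval (p x) = x - projv U x by apply/vsprojK/memv_projC.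
have p_pi x : p (repr (\pi_vquot x)) = p x.
  have : x - repr (\pi_vquot x) \in U by rewrite -vquot_eqE reprK.
  set y := repr _ => xyU; apply: val_inj; rewrite /= !pE; apply/eqP.
  rewrite eq_sym -subr_eq0 opprD addrACA -opprD -linearB /= projv_id //.
  by rewrite subrr.
have [f f_linear f_bij] := subvs_vect_iso U^C.
exists (fun x : vquot => f (p (repr x))).
  move=> a x y; rewrite -f_linear -p_linear; congr (f _).
  by rewrite -[RHS]p_pi linearP /= !reprK.
have [g fK gK] := f_bij; exists (fun r => \pi_vquot (vsval (g r))) => [x | r].
  rewrite fK pE -[RHS]reprK; apply/eqP; rewrite vquot_eqE.
  by rewrite addrAC subrr add0r memvN memv_proj.
rewrite p_pi -[RHS]gK; congr (f _); set w := g r.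
apply: val_inj; rewrite /= pE; suff -> : projv U (vsval w) = 0 by rewrite subr0.
have := @daddv_pi_add _ _ U U^C (vsval w) (capv_compl U).
rewrite addv_complf memvf => /(_ isT); rewrite (@daddv_pi_id _ _ U^C U).
- by move=> /(canRL (addrK _)) ->; rewrite subrr.
- by rewrite capvC capv_compl.
exact: subvsP.
Qed.

HB.instance Definition _ := Lmodule_hasFinDim.Build K vquot vquot_vect_iso.

End VectorQuotient.

Section QuotientAlgebra.

Variables (K : fieldType) (E : nonassocAlgType K) (I : ideal E).

Definition quot_alg := vquot I.

HB.instance Definition _ := Vector.on quot_alg.

Definition quot_proj (x : E) : quot_alg := \pi_(vquot I) x.

Lemma quot_projK (x : quot_alg) : quot_proj (repr x) = x.
Proof. exact: reprK. Qed.

Definition quot_mul (x y : quot_alg) : quot_alg := quot_proj (repr x ** repr y).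

Lemma quot_projM : {morph quot_proj : x y / x ** y >-> quot_mul x y}.
Proof.
move=> x y; apply/eqP; rewrite vquot_eqE.
set x' := repr _; set y' := repr _.
have xI : x - x' \in ideal_val I by rewrite -vquot_eqE reprK.
have yI : y - y' \in ideal_val I by rewrite -vquot_eqE reprK.
have -> : x ** y - x' ** y' = (x - x') ** y + x' ** (y - y').
  by rewrite linearBl linearBr addrA subrK.
by apply: memvD; [have [] := idealP y xI | have [] := idealP x' yI].
Qed.

HB.instance Definition _ := GRing.isSemilinear.Build K E quot_alg *:%R quot_proj
  (GRing.semilinear_linear (@vquot_pi_linear K E I)).

Lemma quot_mul_bilinear : bilinear_for *:%R *:%R quot_mul.
Proof.
split=> x a u v; rewrite -[x]quot_projK -[u]quot_projK -[v]quot_projK.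
  by rewrite -linearP -!quot_projM linearPl linearP.
by rewrite -linearP -!quot_projM linearPr linearP.
Qed.

HB.instance Definition _ :=
  Vector_isNonassocAlg.Build K quot_alg quot_mul_bilinear.

End QuotientAlgebra.

Definition isomorphic (K : fieldType) (A B : nonassocAlgType K) :=
  exists f : {linear A -> B}, bijective f /\ {morph f : x y / x ** y}.

(* Row vectors in coordinates; the natural basis is [delta_mx 0 i], see
   [Ek_mul_delta] and [Ek_natural_basis]. The parameter [lam], unused in the
   carrier, selects the product. *)
Definition evol_Ek (K : fieldType) (k : nat) (lam : 'rV[K]_k) : Type :=
  'rV[K]_k.

Section EvolutionAlgebraEk.

Variables (K : fieldType) (k : nat) (lam : 'rV[K]_k).

HB.instance Definition _ := Vector.on (evol_Ek lam).

Definition Ek_mul (x y : 'rV[K]_k) : 'rV[K]_k :=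
  \sum_i (x 0 i * y 0 i * lam 0 i) *: \sum_j delta_mx 0 j.

Lemma Ek_mul_bilinear : bilinear_for *:%R *:%R Ek_mul.
Proof.
split=> x a u v; rewrite /= /Ek_mul scaler_sumr -big_split /=;
  apply: eq_bigr => i _; rewrite !mxE scalerA -scalerDl; congr (_ *: _).
  by rewrite !mulrDl !mulrA.
by rewrite mulrDr mulrDl !mulrA [x 0 i * a]mulrC.
Qed.

HB.instance Definition _ :=
  Vector_isNonassocAlg.Build K (evol_Ek lam) Ek_mul_bilinear.

Lemma Ek_mul_delta i j : (delta_mx 0 i : evol_Ek lam) ** (delta_mx 0 j) =
  if i == j then lam 0 i *: \sum_l delta_mx 0 l else 0.
Proof.
rewrite -[LHS]/(Ek_mul _ _) /Ek_mul; set e := \sum_(l < k) delta_mx 0 l.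
rewrite (bigD1 i) //= big1 => [|l /negPf li].
  rewrite !mxE !eqxx /= addr0 mul1r; case: eqP => _; first by rewrite mul1r.
  by rewrite mul0r scale0r.
by rewrite !mxE li /= !mul0r scale0r.
Qed.

Lemma Ek_natural_basis :
  @natural_basis K (evol_Ek lam) [seq delta_mx 0 i | i : 'I_k].
Proof.
split=> [|_ _ /mapP[i _ ->] /mapP[j _ ->] dij].
  rewrite basisEdim size_map -cardE card_ord dimvf /dim /= mul1n leqnn andbT.
  apply/subvP=> x _; rewrite [x]row_sum_delta; apply: memv_suml => i _.
  by apply/memvZ/memv_span/map_f; rewrite mem_enum.
rewrite Ek_mul_delta; case: eqP => // ij; by rewrite ij eqxx in dij.
Qed.

End EvolutionAlgebraEk.

(* Main.v *)
(* Under either hypothesis every nonzero quotient Q has an ideal of dimension 1,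
   and lifting such ideals one at a time builds the chain. A line in ann(Q) is
   an ideal; and if J = span(S) is a basic ideal isomorphic to E_k(lam), the
   basis vectors outside S annihilate J, so the vector u of J corresponding to
   e_1 + ... + e_k spans an ideal of Q.
   Conversely, the image in Q of a chain of ideals contains a line <u>. If Q is
   nondegenerate then e_i^2 <> 0 for all i, and u e_i = u_i e_i^2 lies in <u>,
   so e_i^2 is a multiple of u for every i in the support of u. Rescaling e_i
   to u_i e_i identifies the span of that support with some E_k(lam), and
   u^2 = (sum of lam) u must vanish because Q is solvable. *)

From HB Require Import structures.
Require Import Defs.
From mathcomp Require Import all_boot all_algebra.

Set Implicit Arguments.
Unset Strict Implicit.
Unset Printing Implicit Defensive.

Import GRing.Theory.
Local Open Scope ring_scope.

(** * Linear algebra preliminaries *)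

(** The images of a basis in a quotient only span it; dropping each vector already in the span of
    the later ones leaves a basis of the quotient. *)
Lemma ex_free_subset (K : fieldType) (V : vectType K) (X : seq V) :
  exists Y : seq V, [/\ {subset Y <= X}, free Y & <<Y>>%VS = <<X>>%VS].
Proof.
elim: X => [|x X [Y [sYX freeY spanY]]]; first by exists [::]; rewrite nil_free.
have [xY | xY] := boolP (x \in <<Y>>%VS).
  exists Y; split=> // [y /sYX yX|]; first by rewrite inE yX orbT.
  by rewrite span_cons -spanY; apply/esym/addv_idPr; rewrite -memvE.
exists (x :: Y); split; last by rewrite !span_cons spanY.
  by move=> y /[!inE] /orP[-> // | /sYX ->]; rewrite orbT.
by rewrite free_cons xY.
Qed.

Lemma sum_delta_ones (R : pzRingType) k :
  \sum_j delta_mx 0 j = const_mx 1 :> 'rV[R]_k.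
Proof.
rewrite [RHS]row_sum_delta; apply: eq_bigr => j _.
by rewrite mxE scale1r.
Qed.

(** * Products in evolution algebras and their one-dimensional ideals *)

Section AlgebraTheory.

Variables (K : fieldType) (E : nonassocAlgType K).
Implicit Types (B S : seq E) (u x y : E).

Lemma orthogonal_mulE n (T : n.-tuple E) (a b : 'I_n -> K) :
    uniq T -> {in T &, forall x y, x != y -> x ** y = 0} ->
  (\sum_i a i *: T`_i) ** (\sum_j b j *: T`_j)
    = \sum_i (a i * b i) *: (T`_i ** T`_i).
Proof.
move=> uT oT; rewrite linear_sumlz; apply: eq_bigr => i _.
rewrite linear_sumr (bigD1 i) //= big1 => [|j ji].
  by rewrite addr0 linearZr_LR linearZl_LR /= scalerA mulrC.
rewrite linearZr_LR linearZl_LR /= oT ?scaler0 //.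
- by apply: mem_nth; rewrite size_tuple.
- by apply: mem_nth; rewrite size_tuple.
- by rewrite nth_uniq ?size_tuple // eq_sym.
Qed.

(** In natural coordinates the product is diagonal, so commutativity reduces to that of [K]. *)
Lemma evolution_mulC : evolution_algebra E -> commutative (@amul K E).
Proof.
move=> [B [bB oB]] x y.
have uB := free_uniq (basis_free bB).
have mB z : z \in <<in_tuple B>>%VS by rewrite (span_basis bB) memvf.
rewrite (coord_span (mB x)) (coord_span (mB y)) !orthogonal_mulE //.
by apply: eq_bigr => i _; rewrite mulrC.
Qed.

Lemma line_ideal_closed u : evolution_algebra E ->
  (forall x, u ** x \in <[u]>%VS) -> ideal_closed <[u]>%VS.
Proof.
move=> evolE uE x y /vlineP[c ->]; rewrite (evolution_mulC evolE x).
by rewrite linearZl_LR /= memvZ.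
Qed.

(** If u^2 = c u with c nonzero, then u = c^-1 u^2 lies in every derived term, so solvability forces
    u = 0. *)
Lemma solvable_line_sq0 u : solvable E -> ideal_closed <[u]>%VS -> u ** u = 0.
Proof.
move=> [k derk0] idu.
have /vlineP[c uu] := (idu u u (memv_line u)).1.
have [c0 | c0] := eqVneq c 0; first by rewrite uu c0 scale0r.
have: u \in derived E k.
  elim: {derk0} k => [|k IHk] /=; first exact: memvf.
  have -> : u = c^-1 *: (u ** u) by rewrite uu scalerA mulVf // scale1r.
  exact/memvZ/memv_amulv.
by rewrite derk0 memv0 => /eqP->; rewrite linear0l.
Qed.

Lemma orthogonal_mul_nth n (T : n.-tuple E) x (i : 'I_n) :
    uniq T -> {in T &, forall x y, x != y -> x ** y = 0} -> x \in <<T>>%VS ->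
  x ** T`_i = coord T i x *: (T`_i ** T`_i).
Proof.
move=> uT oT xT; rewrite {1}(coord_span xT).
(* Kronecker coefficients bring the i-th vector into the form that [orthogonal_mulE] expects. *)
have {1}-> : T`_i = \sum_j (j == i)%:R *: T`_j.
  rewrite (bigD1 i) //= big1 ?eqxx ?scale1r ?addr0 // => j /negPf->.
  by rewrite scale0r.
rewrite orthogonal_mulE // (bigD1 i) //= big1 => [|j /negPf->].
  by rewrite eqxx mulr1 addr0.
by rewrite mulr0 scale0r.
Qed.

(** Every product in E_k is a multiple of the all-ones vector, which therefore spans an ideal. *)
Lemma Ek_mul_ones k (lam : 'rV[K]_k) (x : evol_Ek lam) :
  (const_mx 1 : evol_Ek lam) ** x
    = (\sum_i (x : 'rV_k) 0 i * lam 0 i) *: (const_mx 1 : 'rV_k).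
Proof.
rewrite -[LHS]/(Ek_mul _ _ _) /Ek_mul scaler_suml; apply: eq_bigr => i _.
by rewrite mxE mul1r -sum_delta_ones.
Qed.

Lemma Ek_line_ideal (J : ideal E) k (lam : 'rV[K]_k) :
    evolution_algebra E -> basic_ideal J -> (0 < k)%N ->
    isomorphic (ideal_alg J) (evol_Ek lam) ->
  exists2 u : E, u != 0 & ideal_closed <[u]>%VS.
Proof.
move=> evolE [B [bB oB] [S sSB JS]] k0 [f [[g fK gK] fM]].
pose w : evol_Ek lam := const_mx 1.
exists (vsval (g w)).
  (* As [0 < k], the all-ones vector [w] is nonzero, and so is its preimage. *)
  apply: contraTneq isT => gw0; have g0 : g w = 0 by apply: val_inj.
  have : (w : 'rV_k) 0 (Ordinal k0) = 1 by rewrite mxE.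
  by rewrite -[w]gK g0 linear0 mxE => /esym/eqP; rewrite oner_eq0.
apply: line_ideal_closed => // x.
have : x \in <<B>>%VS by rewrite (span_basis bB) memvf.
move=> /(coord_span (X := in_tuple B)) ->.
rewrite linear_sumr; apply: memv_suml => i _; rewrite linearZr_LR memvZ //=.
set b := B`_i; have bB' : b \in B by apply: mem_nth.
have [bS | bS] := boolP (b \in S).
  have bJ : b \in ideal_val J by rewrite JS memv_span.
  have : f (g w ** Subvs bJ) =
      f ((\sum_i (f (Subvs bJ) : 'rV_k) 0 i * lam 0 i) *: g w).
    by rewrite fM linearZ /= gK Ek_mul_ones.
  move=> /(can_inj fK) /(congr1 vsval) /= ->.
  exact/memvZ/memv_line.
(* A basis vector [b] outside [S] is orthogonal to all of [S], hence annihilates [J]. *)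
have : vsval (g w) \in <<S>>%VS by rewrite -JS subvsP.
move=> /(coord_span (X := in_tuple S)) ->.
rewrite linear_sumlz big1 ?mem0v // => j _.
have sS : S`_j \in S by apply: mem_nth.
rewrite linearZl_LR /= oB ?scaler0 //; first exact: sSB.
by apply: contraNneq bS => <-.
Qed.

Lemma line_ideal_Ek u :
    solvable E -> evolution_algebra E -> ~~ degenerate E ->
    u != 0 -> ideal_closed <[u]>%VS ->
  exists J : ideal E, basic_ideal J /\
    exists (k : nat) (lam : 'rV[K]_k),
      [/\ (1 <= k <= \dim {:E})%N,
          exists j, lam 0 j != 0,
          \sum_j lam 0 j = 0
        & isomorphic (ideal_alg J) (evol_Ek lam)].
Proof.
move=> solE evolE; rewrite negbK => /eqP ann0 u0 idu.
have mulC := evolution_mulC evolE.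
case: evolE => B [bB oB].
have freeB := basis_free bB; have uB := free_uniq freeB.
have mB z : z \in <<in_tuple B>>%VS by rewrite (span_basis bB) memvf.
have mulB x i := @orthogonal_mul_nth _ (in_tuple B) x i uB oB (mB x).
(* The basis vectors that [u] does not annihilate; by nondegeneracy they form the support of [u]. *)
pose S := [seq b <- B | u ** b != 0]; pose T := in_tuple S.
have sSB : {subset S <= B} by move=> b; rewrite mem_filter => /andP[].
have freeS : free S by exact: filter_free.
have uS := free_uniq freeS.
have oS : {in S &, forall x y, x != y -> x ** y = 0}.
  by move=> x y /sSB xB /sSB yB; exact: oB.
have u_in_S : u \in <<T>>%VS.
  rewrite (coord_span (mB u)); apply: memv_suml => i _; set b := B`_i.
  have bB' : b \in B by apply: mem_nth.
  (* If u b = 0, either the coordinate of u at b vanishes or b^2 = 0; the latter puts b in the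
     annihilator, which is zero. *)
  have [ub | ub] := eqVneq (u ** b) 0; last first.
    by apply/memvZ/memv_span; rewrite mem_filter ub.
  have: coord (in_tuple B) i u *: (b ** b) = 0 by rewrite -mulB.
  move/eqP; rewrite scaler_eq0 => /orP[/eqP-> | /eqP bb0].
    by rewrite scale0r mem0v.
  have: b \in ann E by apply/annP=> y; rewrite mulC mulB bb0 scaler0.
  by rewrite ann0 memv0 => /eqP->; rewrite scaler0 mem0v.
pose a (i : 'I_(size S)) : K := coord T i u.
have mulT (i : 'I_(size S)) : u ** T`_i = a i *: (T`_i ** T`_i).
  exact: orthogonal_mul_nth.
have uT0 (i : 'I_(size S)) : u ** T`_i != 0.
  by have := mem_nth 0 (ltn_ord i); rewrite mem_filter => /andP[].
have a0 i : a i != 0.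
  by apply: contraNneq (uT0 i) => a0; rewrite mulT a0 scale0r.
(* The product of u and T_i is a_i T_i^2 and lies on the line of u; dividing by a_i makes T_i^2 a
   multiple of u. *)
have /fin_all_exists[c cE] : forall i : 'I_(size S),
    exists c, T`_i ** T`_i = c *: u.
  move=> i; have /vlineP[d dE] := (idu T`_i u (memv_line u)).2.
  exists ((a i)^-1 * d).
  by rewrite -scalerA -dE mulT scalerA mulVf // scale1r.
have c0 i : c i != 0.
  by apply: contraNneq (uT0 i) => c0; rewrite mulT cE c0 scale0r scaler0.
have spanT_mul x y : x \in <<T>>%VS -> y \in <<T>>%VS ->
    x ** y = (\sum_i coord T i x * coord T i y * c i) *: u.
  move=> xT yT; rewrite {1}(coord_span xT) {1}(coord_span yT).
  rewrite orthogonal_mulE // scaler_suml.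
  by apply: eq_bigr => i _; rewrite cE scalerA.
(* A vector of [S] times a vector of [B] is zero or a multiple of [u], and [u] lies in the span of
   [S]. *)
have idS : ideal_closed <<S>>%VS.
  move=> x y yS; rewrite (mulC x); suff: y ** x \in <<S>>%VS by [].
  rewrite (coord_span (yS : y \in <<T>>%VS)) linear_sumlz memv_suml // => i _.
  rewrite linearZl_LR /= memvZ // mulC.
  rewrite (coord_span (mB x)) linear_sumlz memv_suml // => j _.
  rewrite linearZl_LR /= memvZ //.
  have [-> | ji] := eqVneq B`_j T`_i; first by rewrite cE memvZ.
  by rewrite oB ?mem0v //; [apply: mem_nth | apply/sSB/mem_nth].
pose J := Ideal idS; exists J; split.
  by exists B => //; exists S.
have k0 : (0 < size S)%N.
  rewrite lt0n; apply: contraNneq u0 => /size0nil S0.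
  by rewrite -memv0 -span_nil -S0.
(* For the rescaled basis e_i = a_i T_i, u is the sum of the e_i and e_i^2 = a_i^2 c_i u. *)
pose lam : 'rV[K]_(size S) := \row_i (a i ^+ 2 * c i).
exists (size S), lam; split.
- by rewrite k0 (size_basis (X := in_tuple B) bB) size_filter count_size.
- by exists (Ordinal k0); rewrite mxE mulf_neq0 ?expf_neq0.
- have /eqP := solvable_line_sq0 solE idu.
  rewrite (spanT_mul u u) // scaler_eq0 (negPf u0) orbF => /eqP sum0.
  by rewrite -[RHS]sum0; apply: eq_bigr => i _; rewrite mxE expr2.
(* Coordinates in the rescaled basis a_i T_i; [g] is the inverse map. *)
pose f (x : ideal_alg J) : evol_Ek lam := \row_i (coord T i (vsval x) / a i).
have f_lin : linear f.
  by move=> d x y; apply/rowP=> i; rewrite !mxE linearP /= mulrDl mulrA.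
pose g (r : 'rV[K]_(size S)) : E := \sum_i (r 0 i * a i) *: T`_i.
have gJ r : g r \in ideal_val J.
  by apply: memv_suml => i _; apply/memvZ/memv_span/mem_nth.
pose F := GRing.isSemilinear.Build K (ideal_alg J) (evol_Ek lam) *:%R f
  (GRing.semilinear_linear f_lin).
pose fL : {linear ideal_alg J -> evol_Ek lam} := HB.pack f F.
exists fL; split=> [|x y] /=.
  exists (fun r => Subvs (gJ r)) => [x | r].
    apply: val_inj => /=; rewrite /g.
    rewrite [RHS](coord_span (subvsP x : _ \in <<T>>%VS)).
    by apply: eq_bigr => i _; rewrite mxE divfK.
  apply/rowP=> i; rewrite mxE /= /g (coord_sum_free (X := T)) //.
  by rewrite mulfK.
rewrite -[RHS]/(Ek_mul _ _ _) /Ek_mul sum_delta_ones -scaler_suml.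
apply/rowP=> i; rewrite !mxE /= spanT_mul ?(subvsP (x : ideal_alg J)) //;
  last exact: (subvsP (y : ideal_alg J)).
rewrite linearZ /= -/(a i) mulfK // mulr1; apply: eq_bigr => j _.
rewrite !mxE [_ / _ * (_ / _)]mulrACA -[RHS]mulrA; congr (_ * _).
by rewrite mulrA -expr2 exprVn mulVf ?expf_neq0 // mul1r.
Qed.

End AlgebraTheory.

(** * Passing to quotients and lifting back *)

Section Quotient.

Variables (K : fieldType) (E : nonassocAlgType K) (I : ideal E).

(** Bundled form of [quot_proj], giving access to images of subspaces and the rank formula. *)
Definition quot_lfun : 'Hom(E, quot_alg I) := linfun (@quot_proj K E I).

Lemma quot_lfunE x : quot_lfun x = quot_proj I x.
Proof. exact: lfunE. Qed.

Lemma limg_quot_lfun : limg quot_lfun = fullv.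
Proof.
apply/vspaceP=> x; rewrite memvf -[x]quot_projK -quot_lfunE.
by rewrite memv_img ?memvf.
Qed.

Lemma quot_proj_eq0 x : (quot_proj I x == 0) = (x \in ideal_val I).
Proof. by rewrite -(linear0 (@quot_proj K E I)) vquot_eqE subr0. Qed.

Lemma quot_proj_amul : {morph quot_proj I : x y / x ** y}.
Proof. exact: quot_projM. Qed.

(** Distinct images of natural basis vectors come from distinct vectors, so they stay orthogonal; a
    free spanning subfamily of the images is a natural basis. *)
Lemma evolution_quot : evolution_algebra E -> evolution_algebra (quot_alg I).
Proof.
move=> [B [bB oB]].
have [Y [sY freeY spanY]] := ex_free_subset (map quot_lfun B).
exists Y; split.
  rewrite /basis_of freeY spanY -limg_span (span_basis bB).
  by rewrite limg_quot_lfun eqxx.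
move=> _ _ /sY/mapP[x xB ->] /sY/mapP[y yB ->] xy.
rewrite !quot_lfunE -quot_proj_amul oB ?linear0 //.
by apply: contraNneq xy => ->.
Qed.

(** Each derived term of the quotient lies in the image of the corresponding term of [E]. *)
Lemma solvable_quot : solvable E -> solvable (quot_alg I).
Proof.
move=> [k derk0]; exists k; apply/eqP; rewrite -subv0.
suff: (derived (quot_alg I) k <= quot_lfun @: derived E k)%VS.
  by rewrite derk0 limg0.
elim: {derk0} k => [|k IHk] /=; first by rewrite limg_quot_lfun.
apply/amulv_subP => x' y' /(subvP IHk)/memv_imgP[x xk ->].
move=> /(subvP IHk)/memv_imgP[y yk ->].
rewrite !quot_lfunE -quot_proj_amul -quot_lfunE.
exact/memv_img/memv_amulv.
Qed.

Lemma dim_quot : (\dim {:quot_alg I} <= \dim {:E})%N.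
Proof. by rewrite -limg_quot_lfun -(limg_ker_dim quot_lfun fullv) leq_addl. Qed.

(** The preimage of the line of [v] is [I] plus the line of a representative of [v]. *)
Lemma lift_line_ideal (v : quot_alg I) :
    v != 0 -> ideal_closed <[v]>%VS ->
  exists2 J : ideal E, (I <= J)%VS & \dim J = (\dim I).+1.
Proof.
move=> v0 idv; pose u : E := repr v.
have pu : quot_proj I u = v by exact: quot_projK.
have uI : u \notin ideal_val I by rewrite -quot_proj_eq0 pu.
have inJ x : (x \in (I + <[u]>)%VS) = (quot_proj I x \in <[v]>%VS).
  apply/memv_addP/vlineP => [[y yI [_ /vlineP[c ->] ->]] | [c xc]].
    exists c; rewrite linearD linearZ /= pu.
    by move: yI; rewrite -quot_proj_eq0 => /eqP->; rewrite add0r.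
  exists (x - c *: u).
    by rewrite -quot_proj_eq0 linearB linearZ /= xc scalerN subrr.
  by exists (c *: u); rewrite ?subrK ?memvZ ?memv_line.
have idJ : ideal_closed (I + <[u]>)%VS.
  by move=> x y; rewrite !inJ !quot_proj_amul; apply: idv.
exists (Ideal idJ) => /=; first exact: addvSl.
rewrite dimv_disjoint_sum ?dim_vline.
  by rewrite (_ : u != 0) ?addn1 //; apply: contraNneq uI => ->; rewrite mem0v.
(* The sum is direct: a nonzero multiple of [u] in [I] would put [u] in [I]. *)
apply/eqP; rewrite -subv0; apply/subvP=> _ /memv_capP[/[swap] /vlineP[c ->]].
have [-> | c0] := eqVneq c 0; first by rewrite scale0r !mem0v.
by rewrite rpredZeq (negPf c0) (negPf uI).
Qed.

(** The first member of the chain not inside [I] exceeds its predecessor, which is inside [I], by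
    one dimension; its image in the quotient is thus a line. *)
Lemma supersolvable_quot_line : supersolvable E -> I != fullv :> {vspace E} ->
  exists2 v : quot_alg I, v != 0 & ideal_closed <[v]>%VS.
Proof.
move=> [C [C0 Cn Cchain Cdim]] If.
have ex : exists i, ~~ (C i <= I)%VS.
  exists (\dim {:E}); rewrite Cn; apply: contra If => sI.
  by rewrite eqEsubv subvf.
have [[|i] nCi mini] := ex_minnP ex; first by rewrite C0 sub0v in nCi.
have CiI : (C i <= I)%VS by apply: contraT => /mini; rewrite ltnn.
have ltin : (i < \dim {:E})%N.
  apply: mini; rewrite Cn; apply: contra If => sI; by rewrite eqEsubv subvf.
have /subvPn[u uC uI] := nCi.
(* By dimension: [u] is outside [I], hence outside [C i], so adding it already reaches dimension i +
   1. *)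
have CE : ideal_val (C i.+1) = (C i + <[u]>)%VS.
  apply/esym/eqP; rewrite eqEdim subv_add -memvE uC.
  have /andP[-> _] := Cchain i ltin; rewrite /= (Cdim i.+1) //.
  rewrite -[X in (X < _)%N](Cdim i (ltnW ltin)).
  rewrite ltnNge; apply: contra uI => le.
  apply: (subvP CiI).
  have /eqP -> : ideal_val (C i) == (C i + <[u]>)%VS.
    by rewrite eqEdim addvSl le.
  exact: (subvP (addvSr _ _)) (memv_line u).
exists (quot_proj I u); first by rewrite quot_proj_eq0.
have inl x : x \in ideal_val (C i.+1) -> quot_proj I x \in <[quot_proj I u]>%VS.
  rewrite CE => /memv_addP[y /(subvP CiI)]; rewrite -quot_proj_eq0 => /eqP y0.
  move=> [_ /vlineP[c ->] ->]; rewrite linearD linearZ /= y0 add0r.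
  exact/memvZ/memv_line.
move=> x _ /vlineP[c ->]; rewrite -[x]quot_projK -linearZ /= -!quot_proj_amul.
have cuC : c *: u \in ideal_val (C i.+1) by rewrite memvZ.
have [l r] := idealP (repr x) cuC.
by split; apply: inl.
Qed.

End Quotient.

(** * Building the chain of ideals, and the equivalence *)

Lemma supersolvable_extend (K : fieldType) (E : nonassocAlgType K) :
    (forall I : ideal E, I != fullv :> {vspace E} ->
      exists2 J : ideal E, (I <= J)%VS & \dim J = (\dim I).+1) ->
  supersolvable E.
Proof.
move=> ext.
have id0 : ideal_closed (0%VS : {vspace E}).
  by move=> x y; rewrite memv0 => /eqP->; rewrite linear0 linear0l mem0v.
have chain m : (m <= \dim {:E})%N -> exists C : nat -> ideal E,
    [/\ ideal_val (C 0%N) = 0%VS,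
        forall i, (i < m)%N -> (C i <= C i.+1)%VS
      & forall i, (i <= m)%N -> \dim (C i) = i].
  elim: m => [_ | m IHm ltm].
    exists (fun=> Ideal id0); split=> // i; rewrite leqn0 => /eqP->.
    exact: dimv0.
  have [C [C0 Cchain Cdim]] := IHm (ltnW ltm).
  have [|J sJ dJ] := ext (C m).
    by apply: contraTneq ltm => Cf; rewrite -Cf Cdim // ltnn.
  (* All indices above [m] receive [J]; only the value at [m.+1] is constrained. *)
  exists (fun i => if (i <= m)%N then C i else J); split=> // i.
    by rewrite ltnS; case: ltngtP => // [ltim | ->] _; first exact: Cchain.
  case: (leqP i m) => [leim _ | ltmi leim]; first exact: Cdim.
  by rewrite dJ Cdim //; apply/anti_leq/andP.
have [C [C0 Cchain Cdim]] := chain _ (leqnn _).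
exists C; split=> // [|i ltin]; first by apply/eqP; rewrite eqEdim subvf /= Cdim.
(* Strictness of the inclusions is read off the dimensions. *)
rewrite Cchain //=; apply/eqP => /(congr1 (fun U => \dim U)).
by rewrite !Cdim ?(ltnW ltin) // => /n_Sn.
Qed.

Theorem theorem4p4 (K : fieldType) (E : nonassocAlgType K)
    (evolE : evolution_algebra E) (solE : solvable E) :
  supersolvable E <->
  (forall I : ideal E, I != fullv :> {vspace E} ->
     degenerate (quot_alg I) \/
     exists J : ideal (quot_alg I), basic_ideal J /\
       exists (k : nat) (lam : 'rV[K]_k),
         [/\ (1 <= k <= \dim {:E})%N,
             exists j, lam 0 j != 0,
             \sum_j lam 0 j = 0
           & isomorphic (ideal_alg J) (evol_Ek lam)]).
Proof.
split=> [ssE I If | quotP].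
  have [deg | ndeg] := boolP (degenerate (quot_alg I)); [by left | right].
  have [v v0 idv] := supersolvable_quot_line ssE If.
  have [J [bJ [k [lam [/andP[k0 kd] lam0 lamS iso]]]]] :=
    line_ideal_Ek (@solvable_quot _ _ I solE) (@evolution_quot _ _ I evolE)
      ndeg v0 idv.
  exists J; split=> //; exists k, lam; split=> //.
  by rewrite k0 (leq_trans kd) ?dim_quot.
apply: supersolvable_extend => I If; have evolQ := @evolution_quot _ _ I evolE.
(* A line that is an ideal of the quotient lifts to an ideal one dimension above [I]. *)
suff [v v0 idv] : exists2 v : quot_alg I, v != 0 & ideal_closed <[v]>%VS.
  exact: lift_line_ideal v0 idv.
have [deg | [J [bJ [k [lam [/andP[k0 _] _ _ iso]]]]]] := quotP I If.
  (* Any nonzero annihilator vector spans an ideal, all its products being zero. *)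
  exists (vpick (ann (quot_alg I))); first by rewrite vpick0.
  apply: line_ideal_closed => // x.
  by have /annP-> := memv_pick (ann (quot_alg I)); rewrite mem0v.
exact: Ek_line_ideal evolQ bJ k0 iso.
Qed.
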